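(* Let $G$ be a finitely generated group with more than one end. Then for every finite generating set $X$ of $G$ there exists a constant $N\in\mathbb{N}$ (depending only on $X$) such that every dead end of $G$ with respect to $X$ has depth at most $N$.
   Context: For a group $G$ with finite generating set $X$, the Cayley graph $\Gamma(G,X)$ is the graph with vertex set $G$ whose edges are the pairs $(g_1,g_2)\in G\times G$ with $g_1^{-1}g_2\in X^{\pm1}=X\cup X^{-1}$. Giving every edge length $1$ yields the metric $d=d_X$ (on $G$ this is the word metric). For $g\in G$ and $r\ge 0$, $B_g(r)=\{h\in G : d(g,h)\le r\}$. An element $g\in G$ with $n=d(1,g)$ is called a dead end with respect to $X$ if $B_g(1)\subseteq B_1(n)$. The depth of a dead end $g$ with $n=d(1,g)$ is $\max\{l : B_g(l)\subseteq B_1(n)\}$. Ends of a graph are equivalence classes of rays in the graph, two rays being equivalent if no finite set of vertices separates them. The number of ends of a finitely generated group $G$ is the number of ends of any of its Cayley graphs with respect to a finite generating set (this number is a quasi-isometry invariant, hence independent of the generating set). Finite groups have no ends. *)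

(* Defs.v *)
From mathcomp Require Import all_boot finmap.
From mathcomp Require Import boolp classical_sets.

Set Implicit Arguments.
Unset Strict Implicit.
Unset Printing Implicit Defensive.

Local Open Scope classical_set_scope.
Local Open Scope group_scope.

(* A graph is given by its adjacency relation [E] on a vertex type [V]. *)
Section Graph.
Variables (V : choiceType) (E : rel V).

Definition walk (u v : V) (p : seq V) : Prop := path E u p /\ last u p = v.

(* Path metric with edges of length 1; it has the junk value 0 when [u] and [v]
   lie in different components, so it is only meaningful on connected graphs. *)
Definition gdist (u v : V) : nat :=
  xget 0%N [set n : nat | (exists2 p, walk u v p & size p = n) /\
                          (forall p, walk u v p -> n <= size p)%N].

Definition gball (u : V) (r : nat) : set V := [set v | (gdist u v <= r)%N].

Definition ray (r : nat -> V) : Prop :=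
  injective r /\ forall n, E (r n) (r n.+1).

(* Separation in the Menger sense: every path between the two rays, including
   the one-vertex paths, meets [K]. Enlarging [K] by initial segments of the rays
   shows that, as [K] ranges over all finite sets, this is the same as having
   tails in different components of the complement of [K]. *)
Definition separates (K : {fset V}) (r s : nat -> V) : Prop :=
  forall (i j : nat) (p : seq V), walk (r i) (s j) p ->
  exists2 v, v \in r i :: p & v \in K.

Definition equiv_rays (r s : nat -> V) : Prop :=
  ~ exists K : {fset V}, separates K r s.

Definition end_of (r : nat -> V) : set (nat -> V) :=
  [set s | ray s /\ equiv_rays r s].

Definition ends : set (set (nat -> V)) := [set end_of r | r in ray].

Definition graph_more_than_one_end : Prop :=
  exists e1 e2, [/\ ends e1, ends e2 & e1 <> e2].

End Graph.

(* Groups are arbitrary, possibly infinite: [groupType] only adds a choice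
   operator to the carrier, which classically every type has. *)
Section Group.
Variable G : groupType.

Definition subgroup (H : set G) : Prop :=
  [/\ H 1, forall x y, H x -> H y -> H (x * y) & forall x, H x -> H x^-1].

Definition generates (X : {fset G}) : Prop :=
  smallest subgroup [set` X] = setT.

Definition finitely_generated : Prop := exists X : {fset G}, generates X.

Definition cayley (X : {fset G}) : rel G :=
  fun g1 g2 => g1^-1 * g2 \in (X `|` [fset x^-1 | x in X])%fset.

(* The number of ends does not depend on the finite generating set, so some
   Cayley graph has more than one end if and only if all of them do. *)
Definition group_more_than_one_end : Prop :=
  exists2 X : {fset G}, generates X & graph_more_than_one_end (cayley X).

Definition wdist (X : {fset G}) : G -> G -> nat := gdist (cayley X).

Definition wball (X : {fset G}) : G -> nat -> set G := gball (cayley X).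

Definition dead_end (X : {fset G}) (g : G) : Prop :=
  wball X g 1 `<=` wball X 1 (wdist X 1 g).

(* [depth X g l] : the maximum defining the depth of [g] exists and equals [l]. *)
Definition depth (X : {fset G}) (g : G) (l : nat) : Prop :=
  wball X g l `<=` wball X 1 (wdist X 1 g) /\
  forall m : nat, wball X g m `<=` wball X 1 (wdist X 1 g) -> (m <= l)%N.

End Group.

(* Main.v *)
Require Import Defs.
From mathcomp Require Import all_boot finmap.
From mathcomp Require Import boolp classical_sets cardinality.

(** The idea is that a translate of the finite set separating two ends is an
    obstacle next to [g], and a geodesic from [1] running past it to a far
    point cannot avoid gaining length.

    As the graph of some finite generating set has two ends, there are rays [r]
    and [s] in it and a finite set [K] meeting every path between them.
    Changing the generating set to [X] only thickens [K]: replacing each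
    [X]-edge by a path of bounded length shows that some ball [B_1(R)] for
    [d = d_X] meets every [X]-path from [r] to [s] ([cayley_barrier]).  Balls
    are finite, so there are [a] on [r] and [b] on [s] at distance more than
    [2R] from [1]; let [N] be the larger of these two distances.

    Now let [g] be any element.  Join [g a] to [1] and then [1] to [g b] by
    geodesics.  Translating by [g^-1] gives a path from [r] to [s], so one of
    the two geodesics, say the one between [1] and [h], passes through some [v]
    with [d(g, v) <= R].  Then
      [d(1, h) = d(1, v) + d(v, h) >= (d(1, g) - R) + (d(g, h) - R) > d(1, g)],
    while [d(g, h) <= N] ([barrier_escape]).  Hence no ball around [g] of radius
    at least [N] lies inside [B_1(d(1, g))], which bounds the depth. *)

Set Implicit Arguments.
Unset Strict Implicit.
Unset Printing Implicit Defensive.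

Local Open Scope classical_set_scope.
Local Open Scope group_scope.

(** * Geodesics in connected graphs *)

Section ConnectedGraph.
Variables (V : choiceType) (E : rel V).
Implicit Types (u v w : V) (p q : seq V).

Lemma walk_cat u v w p q : walk E u v p -> walk E v w q -> walk E u w (p ++ q).
Proof.
move=> [pp lp] [pq lq]; split; first by rewrite cat_path pp lp.
by rewrite last_cat lp.
Qed.

Lemma walk_split u v w p : walk E u v p -> w \in u :: p ->
  exists p1 p2, [/\ walk E u w p1, walk E w v p2 & p = p1 ++ p2].
Proof.
move=> [pp lp] wp; case/splitPl: {p} wp pp lp => p1 p2 lw.
rewrite cat_path last_cat lw => /andP[pp1 pp2] lp2.
by exists p1, p2.
Qed.

Lemma walk_rev u v p : symmetric E -> walk E u v p ->
  exists q, [/\ walk E v u q, size q = size p & v :: q =i u :: p].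
Proof.
move=> symE [pp lp]; exists (rev (belast u p)); split.
- split; last first.
    by case: p {pp} lp => [/= <-//|x p _] /=; rewrite rev_cons last_rcons.
  rewrite -lp rev_path; apply: sub_path pp => x y; by rewrite symE.
- by rewrite size_rev size_belast.
- by move=> x; rewrite -lp -rev_rcons mem_rev -lastI.
Qed.

Hypothesis connE : forall u v, exists p, walk E u v p.

Lemma gdist_spec u v : (exists2 p, walk E u v p & size p = gdist E u v) /\
  (forall p, walk E u v p -> gdist E u v <= size p)%N.
Proof.
have exn : exists n, `[< exists2 p, walk E u v p & size p = n >].
  by have [p wp] := connE u v; exists (size p); apply/asboolP; exists p.
have [n /asboolP nP n_min] := ex_minnP exn.
apply: (@xgetPex _ 0%N [set n | (exists2 p, walk E u v p & size p = n) /\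
  (forall p, walk E u v p -> n <= size p)%N]).
by exists n; split=> // p wp; apply: n_min; apply/asboolP; exists p.
Qed.

Lemma geodesic_exists u v : exists2 p, walk E u v p & size p = gdist E u v.
Proof. by case: (gdist_spec u v). Qed.

Lemma gdist_le_size u v p : walk E u v p -> (gdist E u v <= size p)%N.
Proof. by case: (gdist_spec u v) => _; apply. Qed.

Lemma gdist_triangle v u w : (gdist E u w <= gdist E u v + gdist E v w)%N.
Proof.
have [p wp <-] := geodesic_exists u v; have [q wq <-] := geodesic_exists v w.
by rewrite -size_cat; apply: gdist_le_size; apply: walk_cat wp wq.
Qed.

Lemma gdistxx u : gdist E u u = 0%N.
Proof. by apply/eqP; rewrite -leqn0 (@gdist_le_size u u [::]). Qed.

Lemma gdist_eq0 u v : gdist E u v = 0%N -> u = v.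
Proof.
by have [p [_ lp] <-] := geodesic_exists u v => /size0nil p0; rewrite -lp p0.
Qed.

Lemma geodesic_additive u v w p : walk E u v p -> size p = gdist E u v ->
  w \in u :: p -> (gdist E u w + gdist E w v <= gdist E u v)%N.
Proof.
move=> wp <- /(walk_split wp)[p1 [p2 [w1 w2 ->]]].
by rewrite size_cat leq_add // gdist_le_size.
Qed.

Hypothesis symE : symmetric E.

Lemma gdist_sym u v : gdist E u v = gdist E v u.
Proof.
wlog suff le_uv : u v / (gdist E u v <= gdist E v u)%N.
  by apply/eqP; rewrite eqn_leq !le_uv.
have [p /(walk_rev symE)[q [wq <- _]] <-] := geodesic_exists v u.
exact: gdist_le_size.
Qed.

(** A geodesic entering the [R]-ball around [g] loses at most [2R] compared with
    one passing through [g] itself. *)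
Lemma geodesic_past_ball u g h v R p : walk E u h p -> size p = gdist E u h ->
  v \in u :: p -> (gdist E g v <= R)%N -> (R + R < gdist E g h)%N ->
  (gdist E u g < gdist E u h)%N.
Proof.
move=> wp gp vp gv far; apply: leq_trans (geodesic_additive wp gp vp).
have vh : (R < gdist E v h)%N.
  rewrite -(ltn_add2l R); apply: leq_trans far _.
  by apply: leq_trans (gdist_triangle v g h) _; rewrite leq_add2r.
apply: leq_ltn_trans (gdist_triangle v u g) _.
by rewrite ltn_add2l (leq_ltn_trans _ vh) // gdist_sym.
Qed.

End ConnectedGraph.

(** * Cayley graphs *)

Section Cayley.
Variable G : groupType.
Implicit Types (X Y : {fset G}) (g u v w : G) (p q : seq G).

Lemma cayley_sym X : symmetric (cayley X).
Proof.
apply: symmetric_from_pre => u v; rewrite /cayley !in_fsetU.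
have -> : v^-1 * u = (u^-1 * v)^-1 by rewrite invgM invgK.
case/orP=> [Xx|/imfsetP[x /= Xx ->]].
  by apply/orP; right; apply/imfsetP; exists (u^-1 * v).
by rewrite invgK Xx.
Qed.

Lemma cayley_mul X g u v : cayley X (g * u) (g * v) = cayley X u v.
Proof. by rewrite /cayley invgM -mulgA mulKg. Qed.

Lemma walk_mul X g u v p : walk (cayley X) u v p ->
  walk (cayley X) (g * u) (g * v) [seq g * x | x <- p].
Proof.
move=> [pp lp]; split; last by rewrite last_map lp.
by rewrite path_map; apply: sub_path pp => x y; rewrite /= cayley_mul.
Qed.

Lemma cayley_connected X : generates X ->
  forall u v, exists p, walk (cayley X) u v p.
Proof.
move=> genX.
pose H : set G := [set g | exists p, walk (cayley X) 1 g p].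
have HT : [set: G] `<=` H.
  rewrite -genX; apply: smallest_sub => [|x /= Xx]; last first.
    by exists [:: x]; split; rewrite //= andbT /cayley invg1 mul1g in_fsetU Xx.
  split=> [|x y [p wp] [q wq]|x [p wp]]; first by exists [::].
    exists (p ++ [seq x * z | z <- q]); apply: walk_cat wp _.
    by have := walk_mul x wq; rewrite mulg1.
  have [q [wq _ _]] := walk_rev (cayley_sym X) wp.
  exists [seq x^-1 * z | z <- q].
  by have := walk_mul x^-1 wq; rewrite mulVg mulg1.
move=> u v; have [p wp] := HT (u^-1 * v) I.
by exists [seq u * z | z <- p]; have := walk_mul u wp; rewrite mulg1 mulVKg.
Qed.

Lemma wdist_mul X g u v : generates X -> wdist X (g * u) (g * v) = wdist X u v.
Proof.
move=> /cayley_connected conn.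
wlog suff le_g : g u v / (wdist X (g * u) (g * v) <= wdist X u v)%N.
  apply/eqP; rewrite eqn_leq le_g /=.
  by rewrite -{1}(mulKg g u) -{1}(mulKg g v) le_g.
rewrite /wdist; have [p /(walk_mul g) wp <-] := geodesic_exists conn u v.
by rewrite -(size_map (fun z => g * z) p); apply: gdist_le_size.
Qed.

Lemma wball_finite X u n : generates X -> finite_set (wball X u n).
Proof.
move=> /cayley_connected conn.
suff [B BP] : exists B : {fset G}, forall v p,
    walk (cayley X) u v p -> (size p <= n)%N -> v \in B.
  apply: (@finite_subfset _ B) => v /= uv.
  by have [p wp sp] := geodesic_exists conn u v; apply: (BP v p) => //; rewrite sp.
elim: n => [|n [B BP]].
  exists [fset u]%fset => v p [_ lp]; rewrite leqn0 => /nilP p0.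
  by rewrite -lp p0 /= inE.
set S := (X `|` [fset x^-1 | x in X])%fset.
exists (B `|` [fset w * s | w in B, s in S])%fset => v p.
case/lastP: p => [wp _|p x [+ +]].
  by rewrite in_fsetU (BP v [::]).
rewrite last_rcons rcons_path size_rcons ltnS => /andP[pp Ex] <- sp.
rewrite in_fsetU; apply/orP; right; apply/imfset2P.
exists (last u p); first by apply: (BP _ p).
by exists ((last u p)^-1 * x); rewrite ?mulVKg.
Qed.

Lemma injective_leaves_wball X u n (r : nat -> G) : generates X ->
  injective r -> exists i, (n < wdist X u (r i))%N.
Proof.
move=> genX injr; apply: contrapT => /forallNP in_ball; apply: infinite_nat.
have fin : finite_set (r @^-1` wball X u n).
  by apply: finite_preimage (wball_finite u n genX) => i j _ _; apply: injr.
apply: sub_finite_set fin => i _ /=.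
by rewrite /wball /gball /= leqNgt; apply/negP; apply: in_ball.
Qed.

(** The two word metrics may differ, so a walk cannot be kept as it is when the
    generating set changes; but it is uniformly close to a walk for the other
    one, since up to translation there are only finitely many edges to replace. *)
Lemma walk_refine X Y : generates X -> generates Y ->
  exists C, forall u v p, walk (cayley X) u v p ->
    exists2 q, walk (cayley Y) u v q &
      forall w, w \in u :: q -> exists2 x, x \in u :: p & (wdist X x w <= C)%N.
Proof.
move=> genX genY; have connX := cayley_connected genX.
have /choice[f fP] := cayley_connected genY 1.
(* [C] bounds how far a replacement [f s] strays from its starting point. *)
set S := (X `|` [fset x^-1 | x in X])%fset.
pose C := (\max_(s <- S) \max_(w <- 1%g :: f s) wdist X 1%g w)%N.
exists C => u v p; elim: p u => [|y p IHp] u [/= + lp].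
  move=> _; exists [::] => // w; rewrite inE => /eqP ->.
  by exists u; rewrite ?inE // /wdist gdistxx.
case/andP=> Euy pp; have [q wq qP] := IHp y (conj pp lp).
have := walk_mul u (fP (u^-1 * y)); rewrite mulg1 mulVKg => wuy.
exists ([seq u * z | z <- f (u^-1 * y)] ++ q); first exact: walk_cat wuy wq.
move=> w; rewrite -cat_cons mem_cat => /orP[|wq']; last first.
  have [|x xp xw] := qP w; first by rewrite inE wq' orbT.
  by exists x; rewrite // inE xp orbT.
rewrite -[X in X :: _]mulg1 -(map_cons (fun z => u * z)) => /mapP[z zf ->].
exists u; first by rewrite inE eqxx.
rewrite -{1}(mulg1 u) wdist_mul //.
apply: leq_trans (leq_bigmax_seq (u^-1 * y) Euy isT).
exact: (@leq_bigmax_seq _ _ xpredT (wdist X 1) z).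
Qed.

(** * Barriers between two ends *)

Lemma separated_rays (V : choiceType) (E : rel V) :
  graph_more_than_one_end E ->
  exists r s K, [/\ ray E r, ray E s & separates E K r s].
Proof.
(* Two distinct ends differ by a ray [t] lying in only one of them; [t] is then
   separated from a representative of the other one. *)
move=> [_ [_ [[r rayr <-] [s rays <-] nrs]]].
have sep a b : ray E a -> ~ (end_of E b `<=` end_of E a) ->
    exists r s K, [/\ ray E r, ray E s & separates E K r s].
  move=> raya /existsNP[t /not_implyP[[rayt _] nat]].
  have [K Ksep] : exists K, separates E K a t by apply: contrapT => nK; apply: nat.
  by exists a, t, K.
have [rs|] := pselect (end_of E r `<=` end_of E s); last exact: sep.
apply: (sep r s) => // sr; apply: nrs; exact/seteqP.
Qed.

Lemma cayley_barrier X : group_more_than_one_end G -> generates X ->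
  exists (r s : nat -> G) R, [/\ injective r, injective s &
    forall i j p, walk (cayley X) (r i) (s j) p ->
      exists2 v, v \in r i :: p & (wdist X 1 v <= R)%N].
Proof.
move=> [Y genY /separated_rays[r [s [K [[injr _] [injs _] Ksep]]]]] genX.
have [C CP] := walk_refine genX genY.
have connX := cayley_connected genX.
exists r, s, (\max_(k <- K) wdist X 1%g k + C)%N; split=> // i j p /CP[q wq qP].
have [k kq kK] := Ksep i j q wq; have [x xp xk] := qP k kq.
exists x => //; apply: leq_trans (gdist_triangle connX k 1 x) _.
rewrite (gdist_sym connX (cayley_sym X) k).
exact: leq_add (leq_bigmax_seq k kK isT) xk.
Qed.

(** The ball of radius [R] around [g] is a barrier between [g * a] and [g * b],
    so it meets one of the geodesics joining them to [1]. *)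
Lemma barrier_escape X R a b : generates X ->
  (forall p, walk (cayley X) a b p ->
     exists2 v, v \in a :: p & (wdist X 1 v <= R)%N) ->
  (R + R < wdist X 1 a)%N -> (R + R < wdist X 1 b)%N ->
  forall g, (wdist X 1 g < wdist X 1 (g * a))%N
         \/ (wdist X 1 g < wdist X 1 (g * b))%N.
Proof.
move=> genX barrier fara farb g; have connX := cayley_connected genX.
have symX := cayley_sym X.
have far h : (R + R < wdist X 1 h)%N -> (R + R < wdist X g (g * h))%N.
  by rewrite -{1}(mulg1 g) wdist_mul.
have [p wp gp] := geodesic_exists connX 1 (g * a).
have [q wq gq] := geodesic_exists connX 1 (g * b).
have [p' [wp' _ pp']] := walk_rev symX wp.
have := walk_mul g^-1 (walk_cat wp' wq); rewrite !mulKg.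
case/barrier=> v + vR; rewrite -{1}(mulKg g a) -map_cons => /mapP[z + vE].
have gz : (wdist X g z <= R)%N.
  by move: vR; rewrite vE -(wdist_mul g _ _ genX) mulg1 mulVKg.
rewrite -cat_cons mem_cat pp' => /orP[zp|zq].
  by left; apply: (geodesic_past_ball connX symX wp gp zp gz); apply: far.
have zq1 : z \in 1 :: q by rewrite inE zq orbT.
by right; apply: (geodesic_past_ball connX symX wq gq zq1 gz); apply: far.
Qed.

End Cayley.

(** * Bounded depth *)

Theorem theorem2 (G : groupType)
    (hfg : finitely_generated G) (hends : group_more_than_one_end G)
    (X : {fset G}) (hX : generates X) :
  exists N : nat, forall g : G, dead_end X g ->
    exists2 l : nat, depth X g l & (l <= N)%N.
Proof.
have [r [s [R [injr injs barrier]]]] := cayley_barrier hends hX.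
have [i fari] := injective_leaves_wball 1 (R + R) hX injr.
have [j farj] := injective_leaves_wball 1 (R + R) hX injs.
pose N := maxn (wdist X 1 (r i)) (wdist X 1 (s j)); exists N => g _.
pose inside m := wball X g m `<=` wball X 1 (wdist X 1 g).
have inside_le m : inside m -> (m <= N)%N.
  move=> gm; rewrite leqNgt; apply/negP; rewrite /N gtn_max => /andP[im jm].
  have no_escape h : (wdist X 1 h < m)%N ->
      ~ (wdist X 1 g < wdist X 1 (g * h))%N.
    move=> hm; apply/negP; rewrite -leqNgt; apply: gm.
    change (wdist X g (g * h) <= m)%N.
    by rewrite -{1}(mulg1 g) wdist_mul // ltnW.
  by case: (barrier_escape hX (barrier i j) fari farj g); apply: no_escape.
have ex_inside : exists m, `[< inside m >].
  exists 0%N; apply/asboolP => v /=; rewrite /wball /gball /= leqn0 => /eqP.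
  by move/(gdist_eq0 (cayley_connected hX)) <-.
have ub m : `[< inside m >] -> (m <= N)%N.
  by move=> /asboolP; apply: inside_le.
have [l /asboolP ins l_max] := ex_maxnP ex_inside ub.
exists l; last exact: inside_le.
by split=> // m gm; apply: l_max; apply/asboolP.
Qed.
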